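(* Let $(\mathbb{S},\Sigma)$ be a measurable space, $\{\mu^{(n)}\}_{n=1,2,\ldots}\subset\mathcal{M}(\mathbb{S})$, let $\mu$ be a measure on $\mathbb{S}$, and let $\{\tilde\mu,\tilde\mu^{(n)}\}_{n=1,2,\ldots}$ be a sequence of finite signed measures on $\mathbb{S}$. Assume that $\tilde\mu\ll\mu$ and $\tilde\mu^{(n)}\ll\mu^{(n)}$ for each $n=1,2,\ldots$. If the sequence $\{\mu^{(n)}\}_{n=1,2,\ldots}$ converges in total variation to $\mu$, then the sequence $\{\tilde\mu^{(n)}\}_{n=1,2,\ldots}$ converges in total variation to $\tilde\mu$, that is, $$\lim_{n\to\infty}\ \sup_{S\in\Sigma}\left|\tilde\mu^{(n)}(S)-\tilde\mu(S)\right|=0,$$ if and only if the following two statements hold: (i) the sequence $\left\{\frac{d\tilde\mu^{(n)}}{d\mu^{(n)}}\right\}_{n=1,2,\ldots}$ converges in measure $\mu$ to $\frac{d\tilde\mu}{d\mu}$, and, therefore (as a consequence), there exists a subsequence $\left\{\frac{d\tilde\mu^{(n_k)}}{d\mu^{(n_k)}}\right\}_{k=1,2,\ldots}$ of $\left\{\frac{d\tilde\mu^{(n)}}{d\mu^{(n)}}\right\}_{n=1,2,\ldots}$ that converges $\mu$-a.e. to $\frac{d\tilde\mu}{d\mu}$; (ii) the following equality holds: $$\lim_{K\to+\infty}\ \sup_{n=1,2,\ldots}|\tilde\mu^{(n)}|\left(\left\{s\in\mathbb{S}:\left|\frac{d\tilde\mu^{(n)}}{d\mu^{(n)}}(s)\right|\ge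 K\right\}\right)=0,$$ where $|\tilde\mu^{(n)}|(S)=\int_S\left|\frac{d\tilde\mu^{(n)}}{d\mu^{(n)}}(s)\right|\mu^{(n)}(ds)$, $S\in\Sigma$.
   Context: $\mathcal{M}(\mathbb{S})$ is the family of finite (nonnegative) measures on $(\mathbb{S},\Sigma)$. For $\mu\in\mathcal{M}(\mathbb{S})$ and a measure $\nu$ on $\mathbb{S}$, $\mathrm{dist}(\mu,\nu):=\sup\{|\int_{\mathbb{S}} g\,d\mu-\int_{\mathbb{S}} g\,d\nu| : g:\mathbb{S}\to[-1,1]\text{ measurable}\}$; finite measures $\mu^{(n)}$ converge in total variation to a measure $\mu$ if $\lim_{n\to\infty}\mathrm{dist}(\mu^{(n)},\mu)=0$ (then $\mu$ is automatically finite). $\frac{d\tilde\nu}{d\nu}$ denotes (a version of) the Radon–Nikodym derivative of a finite signed measure $\tilde\nu$ with respect to a finite measure $\nu$ with $\tilde\nu\ll\nu$. Convergence in measure $\mu$ of $g^{(n)}$ to $g$ means $\mu(\{s\in\mathbb{S}:|g^{(n)}(s)-g(s)|\ge\varepsilon\})\to0$ as $n\to\infty$ for each $\varepsilon>0$. *)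

(* Defs.v *)
From mathcomp Require Import all_boot all_order all_algebra.
From mathcomp Require Import all_classical all_reals all_analysis.

Set Implicit Arguments.
Unset Strict Implicit.
Unset Printing Implicit Defensive.

Import Order.TTheory GRing.Theory Num.Theory.
Import numFieldNormedType.Exports.

Local Open Scope classical_set_scope.
Local Open Scope ring_scope.
Local Open Scope ereal_scope.
Local Open Scope charge_scope.

(* If exactly one of [mu] and [nu] is infinite, the test function 1 gives
   [dist mu nu = +oo], so [dist] is meaningful for a measure [nu] that is not
   known to be finite. *)
Definition dist {d : measure_display} {T : measurableType d} {R : realType}
    (mu nu : {measure set T -> \bar R}) : \bar R :=
  ereal_sup [set `| \int[mu]_x (g x)%:E - \int[nu]_x (g x)%:E | | g in
    [set g : T -> R | measurable_fun setT g /\ forall x, (-1 <= g x <= 1)%R]].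

Definition cvg_tv {d : measure_display} {T : measurableType d} {R : realType}
    (mu_ : nat -> {finite_measure set T -> \bar R})
    (mu : {measure set T -> \bar R}) : Prop :=
  dist (mu_ n) mu @[n --> \oo] --> 0.

Definition charge_cvg_tv {d : measure_display} {T : measurableType d}
    {R : realType} (nu_ : nat -> {charge set T -> \bar R})
    (nu : {charge set T -> \bar R}) : Prop :=
  ereal_sup [set `| nu_ n A - nu A | | A in measurable] @[n --> \oo] --> 0.

(* [f] is a (real-valued) version of the derivative of [nu] with respect to
   [mu]. The library's ['d nu '/d mu] is one particular version, available only
   once [mu] is known to be sigma-finite. *)
Definition is_RN {d : measure_display} {T : measurableType d} {R : realType}
    (nu : {charge set T -> \bar R}) (mu : {measure set T -> \bar R})
    (f : T -> R) : Prop :=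
  mu.-integrable setT (EFin \o f) /\
  forall A, measurable A -> nu A = \int[mu]_(x in A) (f x)%:E.

Lemma is_RN_Radon_Nikodym (d : measure_display) (T : measurableType d)
    (R : realType) (nu : {charge set T -> \bar R})
    (mu : {sigma_finite_measure set T -> \bar R}) :
  nu `<< mu -> is_RN nu mu (fine \o 'd nu '/d mu).
Proof.
move=> numu.
have E : EFin \o (fine \o 'd nu '/d mu) = 'd nu '/d mu.
  by apply/funext => x /=; rewrite fineK// Radon_Nikodym_fin_num.
split; first by rewrite E; exact: Radon_Nikodym_integrable.
move=> A mA; rewrite (Radon_Nikodym_integral numu mA) -[in LHS]E.
exact: eq_integral.
Qed.

Definition cvg_in_measure {d : measure_display} {T : measurableType d}
    {R : realType} (mu : {measure set T -> \bar R})
    (g_ : nat -> T -> R) (g : T -> R) : Prop :=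
  forall e : R, (0 < e)%R ->
    mu [set s | (e <= `|g_ n s - g s|)%R] @[n --> \oo] --> 0.

Definition has_ae_cvg_subseq {d : measure_display} {T : measurableType d}
    {R : realType} (mu : {measure set T -> \bar R})
    (g_ : nat -> T -> R) (g : T -> R) : Prop :=
  exists2 k_ : nat -> nat, {homo k_ : i j / (i < j)%N} &
    {ae mu, forall s, g_ (k_ k) s @[k --> \oo] --> g s}.

Definition density_variation {d : measure_display} {T : measurableType d}
    {R : realType} (mu : {measure set T -> \bar R}) (g : T -> R)
    (A : set T) : \bar R :=
  \int[mu]_(s in A) `|g s|%:E.

(* Main.v *)
Require Import Defs.
From mathcomp Require Import all_boot all_order all_algebra.
From mathcomp Require Import all_classical all_reals all_analysis.
From mathcomp Require Import measurable_realfun ring lra.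

Import Order.TTheory GRing.Theory Num.Theory.
Import numFieldNormedType.Exports.

Local Open Scope classical_set_scope.
Local Open Scope ring_scope.
Local Open Scope ereal_scope.

Set Implicit Arguments.
Unset Strict Implicit.
Unset Printing Implicit Defensive.

(** The argument is quantitative: every step is an inequality between two
finite measures [mu'] and [mu] with [dist mu' mu <= delta], and two densities
[f'] and [f]. Its source is the fact that a function bounded by [K] on [A] has
[mu']- and [mu]-integrals over [A] that differ by at most [K * delta]
([dist_le_bounded]). Densities are not bounded, so each direction has to find a
way to apply this only to bounded functions.

Suppose that the integrals of [f'] against [mu'] and of [f] against [mu] differ
by at most [eta] over every measurable set.
- On a set [A] where [f + eps <= f'] and [`|f| <= K], integrate [f + eps], which
  is bounded there, and never [f'], which need not be. This gives
  [eps * mu A <= eta + (K + eps) * delta] ([excess_measure_le]). Together with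
  the same bound for [- f'] and [- f], and with the fact that [`|f| >= K] on a
  set of small measure, this is convergence in measure.
- Splitting a set [E] according to the sign of [f'] gives
  [\int_E |f'| dmu' <= \int_E |f| dmu + 2 * eta] ([integral_norm_le]). With
  [E] the set where [`|f'| >= K], which has small [mu]-measure by convergence in
  measure, absolute continuity of the integral of [`|f|] bounds all but finitely
  many of the tails; each of the remaining ones vanishes as [K] grows because
  each single density is integrable.

Conversely, truncate both densities at level [K]. The truncation errors are
bounded by the tails, which are uniformly small by hypothesis. The truncated
densities are bounded by [K], so [mu'] may be replaced by [mu] at cost
[K * delta], after which convergence in measure compares them
([integral_dist_le]).

The almost everywhere convergent subsequence is F. Riesz's theorem
([cvg_in_measure_ae_subseq]): along a subsequence with summable exceptional
measures, the Borel-Cantelli lemma applies. *)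

(** * Convergence of nonnegative extended reals to zero *)

Lemma cvge0_leP (R : realType) (I : Type) (F : set_system I) {FF : Filter F}
    (f : I -> \bar R) : (forall i, 0 <= f i) ->
  (f i @[i --> F] --> 0 <->
   forall e : R, (0 < e)%R -> \forall i \near F, f i <= e%:E).
Proof.
move=> f0; split=> [/fine_cvgP[ffin /cvgrPdist_le fc] e e0|fe].
  near=> i.
  have fi : f i \is a fin_num by near: i.
  have /= : (`|0 - fine (f i)| <= e)%R by near: i; exact: fc.
  by rewrite sub0r normrN ger0_norm ?fine_ge0// -lee_fin fineK.
apply/fine_cvgP; split.
  near=> i; rewrite ge0_fin_numE//.
  have : f i <= 1%:E by near: i; exact: fe.
  by move=> /le_lt_trans; apply; rewrite ltry.
apply/cvgrPdist_le => e e0; near=> i => /=.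
have fi : f i <= e%:E by near: i; exact: fe.
rewrite sub0r normrN ger0_norm ?fine_ge0// -lee_fin fineK//.
by rewrite ge0_fin_numE// (le_lt_trans fi)// ltry.
Unshelve. all: by end_near. Qed.

Lemma near_forall_ltn (I : Type) (F : set_system I) {FF : Filter F}
    (P : nat -> I -> Prop) (N : nat) :
  (forall n, \forall i \near F, P n i) ->
  \forall i \near F, forall n, (n < N)%N -> P n i.
Proof.
move=> FP; elim: N => [|N IH]; first exact: nearW.
near=> i => n; rewrite ltnS leq_eqVlt => /predU1P[->|nN].
  by near: i; exact: FP.
by apply: (near IH i).
Unshelve. all: by end_near. Qed.

(** * Integrals of real densities, their tails, and total variation *)

Section integrals.
Context {d : measure_display} {T : measurableType d} {R : realType}.
Implicit Types (mu : {measure set T -> \bar R}) (f : T -> R) (A : set T) (K : R).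

Lemma measurable_level f A K : measurable A -> measurable_fun A f ->
  measurable (A `&` [set s | (K <= `|f s|)%R]).
Proof.
move=> mA mf; apply: measurable_fun_le => //.
exact: measurableT_comp.
Qed.

Lemma measurable_levelT f K : measurable_fun setT f ->
  measurable [set s | (K <= `|f s|)%R].
Proof. by move=> /(measurable_level K measurableT); rewrite setTI. Qed.

Lemma integrable_measurable mu f A :
  mu.-integrable A (EFin \o f) -> measurable_fun A f.
Proof. by move=> /(measurable_int mu) /measurable_EFinP. Qed.

Lemma EFin_Rintegral mu A f : measurable A -> mu.-integrable A (EFin \o f) ->
  (\int[mu]_(x in A) f x)%R%:E = \int[mu]_(x in A) (f x)%:E.
Proof. by move=> mA fi; rewrite fineK//; exact: (integrable_fin_num mA fi). Qed.

Lemma integrable_sub mu A f : measurable A ->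
  mu.-integrable setT (EFin \o f) -> mu.-integrable A (EFin \o f).
Proof. by move=> mA; apply: integrableS. Qed.

Lemma integrable_norm_sub mu A f : measurable A ->
  mu.-integrable setT (EFin \o f) ->
  mu.-integrable A (EFin \o (fun x => `|f x|%R)).
Proof. by move=> mA fi; apply: integrable_sub => //; exact: integrable_norm. Qed.

Lemma density_variationE mu f A : measurable A ->
  mu.-integrable setT (EFin \o f) ->
  density_variation mu f A = (\int[mu]_(x in A) `|f x|)%R%:E.
Proof.
by move=> mA fi; rewrite EFin_Rintegral//; exact: integrable_norm_sub.
Qed.

Lemma density_variation_ge0 mu f A : 0 <= density_variation mu f A.
Proof. exact: integral_ge0. Qed.

Lemma bounded_integrable mu A f K : measurable A -> mu setT < +oo ->
  measurable_fun A f -> (forall x, A x -> (`|f x| <= K)%R) ->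
  mu.-integrable A (EFin \o f).
Proof.
move=> mA muT mf fK; apply: measurable_bounded_integrable => //.
  by apply: le_lt_trans muT; rewrite le_measure// inE.
exists K; split; first exact: num_real.
by move=> M KM x Ax; exact: le_trans (fK _ Ax) (ltW KM).
Qed.

(** Markov's inequality: the level set at [K] has measure at most
[(\int |f| dmu) / K]. *)
Lemma cvg_measure_level mu f : mu.-integrable setT (EFin \o f) ->
  mu [set s | (K <= `|f s|)%R] @[K --> +oo%R] --> 0.
Proof.
move=> fi; apply/cvge0_leP => // e e0.
have mf := integrable_measurable fi.
set I := (\int[mu]_x `|f x|)%R.
have I0 : (0 <= I)%R by exact: Rintegral_ge0.
near=> K.
have K0 : (0 < K)%R by near: K; exact: nbhs_pinfty_gt.
have KI : (I / e <= K)%R by near: K; apply: nbhs_pinfty_ge; exact: num_real.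
have := le_integral_abse mu measurableT ((measurable_EFinP _ _).2 mf) K0.
rewrite setTI /= -(@EFin_Rintegral mu setT (fun x => `|f x|%R))//; last first.
  exact: integrable_norm_sub.
under eq_set do rewrite lee_fin.
rewrite muleC -lee_pdivlMr// => /le_trans; apply.
by rewrite -/I lee_fin ler_pdivrMr// mulrC -ler_pdivrMr.
Unshelve. all: by end_near. Qed.

(** The level sets have vanishing measure, and the integral of [`|f|] is
absolutely continuous with respect to [mu]. *)
Lemma cvg_density_variation_level mu f : mu.-integrable setT (EFin \o f) ->
  density_variation mu f [set s | (K <= `|f s|)%R] @[K --> +oo%R] --> 0.
Proof.
move=> fi; apply/cvge0_leP => [K|e e0]; first exact: density_variation_ge0.
have [d0 [d00 H]] := integral_normr_continuous fi e0.
have d20 : (0 < d0 / 2)%R by rewrite divr_gt0.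
have /cvge0_leP small := cvg_measure_level fi.
near=> K.
have muK : mu [set s | (K <= `|f s|)%R] <= (d0 / 2)%:E.
  by near: K; exact: small.
have mK := measurable_levelT K (integrable_measurable fi).
rewrite density_variationE// lee_fin ltW// H//.
by apply: le_lt_trans muK _; rewrite lte_fin; lra.
Unshelve. all: by end_near. Qed.

(** Dividing [f], extended by zero outside [A], by [K] gives an admissible test
function in the supremum that defines [dist]. Boundedness is only asked on [A]:
this is what lets [excess_measure_le] restrict to a level set of a density. *)
Lemma dist_le_bounded mu' mu A f (K delta : R) : measurable A ->
  mu' setT < +oo -> mu setT < +oo -> measurable_fun A f -> (0 < K)%R ->
  (forall x, A x -> (`|f x| <= K)%R) -> dist mu' mu <= delta%:E ->
  (`|\int[mu']_(x in A) f x - \int[mu]_(x in A) f x| <= K * delta)%R.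
Proof.
move=> mA mu'T muT mf K0 fK.
have fAK x : (`|(f \_ A) x| <= K)%R.
  rewrite patchE; case: (boolP (x \in A)) => [/set_mem Ax|_]; first exact: fK.
  by rewrite normr0 ltW.
have mfA : measurable_fun setT (f \_ A).
  exact: (measurable_restrictT f mA).1 mf.
have fAi (m : {measure set T -> \bar R}) : m setT < +oo ->
    m.-integrable setT (EFin \o (f \_ A)).
  by move=> mT; apply: (@bounded_integrable _ _ _ K).
have scaled (m : {measure set T -> \bar R}) : m setT < +oo ->
    \int[m]_x (K^-1 * (f \_ A) x)%:E = (K^-1 * \int[m]_(x in A) f x)%R%:E.
  move=> mT; rewrite Rintegral_mkcond -RintegralZl// ?EFin_Rintegral//.
    exact: integrableZl (fAi _ mT).
  exact: fAi.
apply: contraTT; rewrite -!ltNge => lt_dist.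
apply: (@lt_le_trans _ _ (`|\int[mu']_x (K^-1 * (f \_ A) x)%:E
                            - \int[mu]_x (K^-1 * (f \_ A) x)%:E|)).
  rewrite !scaled// -EFinB -mulrBr abse_EFin lte_fin normrM.
  by rewrite gtr0_norm ?invr_gt0// ltr_pdivlMl.
apply: ereal_sup_ubound; exists (fun x => K^-1 * (f \_ A) x)%R => //.
split=> [|x]; first exact: measurable_funM.
by rewrite -ler_norml normrM gtr0_norm ?invr_gt0// ler_pdivrMl// mulr1.
Qed.

End integrals.

(** * Truncation of real numbers *)

Section truncation.
Context {R : realType}.
Implicit Types K x y : R.
Local Open Scope ring_scope.

Definition truncate K x : R := Num.max (- K) (Num.min x K).

Lemma truncate_bound K x : 0 < K -> `|truncate K x| <= K.
Proof.
move=> K0; rewrite ler_norml /truncate.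
by case: (lerP x K) => ?; [case: (lerP (- K) x)|case: (lerP (- K) K)] => ?; lra.
Qed.

Lemma truncate_id K x : `|x| < K -> truncate K x = x.
Proof.
rewrite ltr_norml /truncate => /andP[? ?].
by case: (lerP x K) => ?; [case: (lerP (- K) x)|case: (lerP (- K) K)] => ?; lra.
Qed.

Lemma truncate_dist_le K x : 0 < K -> `|x - truncate K x| <= `|x|.
Proof.
move=> K0; rewrite /truncate.
by case: (lerP x K) => ?; [case: (lerP (- K) x)|case: (lerP (- K) K)] => ?;
  case: (ger0P x) => ?; rewrite ler_norml; lra.
Qed.

Lemma truncate_lip K x y : `|truncate K x - truncate K y| <= `|x - y|.
Proof.
have /andP[? ?] : - `|x - y| <= x - y <= `|x - y| by rewrite -ler_norml.
have ? : 0 <= `|x - y| by [].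
rewrite ler_norml /truncate.
by case: (lerP x K) => ?; case: (lerP y K) => ?;
  case: (lerP (- K) x) => ?; case: (lerP (- K) y) => ?;
  case: (lerP (- K) K) => ?; lra.
Qed.

End truncation.

(** * Quantitative comparison of two densities *)

Section bounds.
Context {d : measure_display} {T : measurableType d} {R : realType}.
Variables (mu' mu : {measure set T -> \bar R}) (f' f : T -> R).
Hypotheses (mu'T : mu' setT < +oo) (muT : mu setT < +oo).
Implicit Types (A E : set T) (K eps delta eta : R).
Local Open Scope ring_scope.

Lemma fin_measure (m : {measure set T -> \bar R}) A :
  (m setT < +oo)%E -> measurable A -> (m A < +oo)%E.
Proof. by move=> mT mA; apply: le_lt_trans mT; rewrite le_measure// inE. Qed.

Lemma measurable_truncate A g K : measurable_fun A g ->
  measurable_fun A (truncate K \o g).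
Proof.
move=> mg; rewrite /truncate /comp.
by apply: measurable_maxr => //; exact: measurable_minr.
Qed.

(** The chain is
[\int_A f dmu + eps * mu A = \int_A (f + eps) dmu
 <= \int_A (f + eps) dmu' + (K + eps) * delta
 <= \int_A f' dmu' + (K + eps) * delta
 <= \int_A f dmu + eta + (K + eps) * delta].
The change of measure is applied to [f + eps], which is bounded on [A]; the
possibly unbounded [f'] only enters through its integral against [mu']. *)
Lemma excess_measure_le A K eps delta eta : measurable A ->
  mu'.-integrable setT (EFin \o f') -> mu.-integrable setT (EFin \o f) ->
  0 < K -> 0 < eps -> (dist mu' mu <= delta%:E)%E ->
  `|\int[mu']_(x in A) f' x - \int[mu]_(x in A) f x| <= eta ->
  (forall x, A x -> `|f x| <= K /\ f x + eps <= f' x) ->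
  eps * fine (mu A) <= eta + (K + eps) * delta.
Proof.
move=> mA f'i fi K0 e0 distd feta fA.
have mf : measurable_fun A f.
  exact: measurable_funTS (integrable_measurable fi).
have mfe : measurable_fun A (fun x => f x + eps) by exact: measurable_funD.
have fe_le x : A x -> `|f x + eps| <= K + eps.
  move=> /fA[fK _]; rewrite (le_trans (ler_normD _ _))//.
  by rewrite lerD// gtr0_norm.
have Ke0 : 0 < K + eps by rewrite addr_gt0.
have := dist_le_bounded mA mu'T muT mfe Ke0 fe_le distd.
have fAi : mu.-integrable A (EFin \o f) by exact: integrable_sub.
have ei : mu.-integrable A (EFin \o cst eps).
  by apply: (@bounded_integrable _ _ _ _ _ _ `|eps|%R).
rewrite (RintegralD mA fAi ei) (@Rintegral_cst _ _ _ mu _ mA eps).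
have : \int[mu']_(x in A) (f x + eps) <= \int[mu']_(x in A) f' x.
  apply: le_Rintegral => //.
  - exact: (@bounded_integrable _ _ _ _ _ _ (K + eps)).
  - exact: integrable_sub.
  - by move=> x /fA[].
move: feta; rewrite !ler_norml => /andP[? ?] ? /andP[? ?]; lra.
Qed.

(** The integral of [`|f'|] is the integral of [f'] over the part of [E] where
[f' >= 0] minus that over the rest; each costs one [eta]. *)
Lemma integral_norm_le E eta : measurable E ->
  mu'.-integrable setT (EFin \o f') -> mu.-integrable setT (EFin \o f) ->
  (forall A, measurable A ->
     `|\int[mu']_(x in A) f' x - \int[mu]_(x in A) f x| <= eta) ->
  \int[mu']_(x in E) `|f' x| <= \int[mu]_(x in E) `|f x| + 2 * eta.
Proof.
move=> mE f'i fi feta.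
have mf' := integrable_measurable f'i.
pose P := E `&` [set x | 0 <= f' x]; pose N := E `\` [set x | 0 <= f' x].
have mpos : measurable [set x | 0 <= f' x].
  by rewrite -[X in measurable X]setTI; exact: measurable_fun_le.
have mP : measurable P by exact: measurableI.
have mN : measurable N by exact: measurableD.
have EPN : E = P `|` N by rewrite /P /N setDE -setIUr setUv setIT.
have PN : [disjoint P & N].
  by apply/disj_setPS => x [[_ ?] [_]].
rewrite [in leLHS]EPN [in leRHS]EPN !Rintegral_setU//; last 2 first.
- by apply: integrable_norm_sub => //; exact: measurableU.
- by apply: integrable_norm_sub => //; exact: measurableU.
have -> : \int[mu']_(x in P) `|f' x| = \int[mu']_(x in P) f' x.
  by apply: eq_Rintegral => x /set_mem[_ /ger0_norm].
have -> : \int[mu']_(x in N) `|f' x| = - \int[mu']_(x in N) f' x.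
  rewrite -mulN1r -RintegralZl//; last exact: integrable_sub.
  apply: eq_Rintegral => x /set_mem[_ /= /negP]; rewrite -ltNge => /ltr0_norm->.
  by rewrite mulN1r.
have := le_normr_Rintegral mP (integrable_sub mP fi).
have := le_normr_Rintegral mN (integrable_sub mN fi).
have := feta _ mP; have := feta _ mN.
rewrite !ler_norml => /andP[? ?] /andP[? ?] /andP[? ?] /andP[? ?]; lra.
Qed.

(** The truncation error vanishes where [`|g| < K] and is at most [`|g|]
elsewhere. *)
Lemma truncate_integral_le (m : {measure set T -> \bar R}) g A K :
  (m setT < +oo)%E -> measurable A -> m.-integrable setT (EFin \o g) -> 0 < K ->
  `|\int[m]_(x in A) g x - \int[m]_(x in A) truncate K (g x)| <=
  \int[m]_(x in [set x | K <= `|g x|]) `|g x|.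
Proof.
move=> mT mA gi K0.
have mg := integrable_measurable gi.
have gA := integrable_sub mA gi.
have mgA := integrable_measurable gA.
have tA : m.-integrable A (EFin \o (truncate K \o g)).
  apply: (@bounded_integrable _ _ _ _ _ _ K) => //.
    exact: measurable_truncate.
  by move=> x _; exact: truncate_bound.
have mL := measurable_levelT K mg.
rewrite -(RintegralB mA gA tA).
apply: le_trans (le_normr_Rintegral mA (integrableB mA gA tA)) _.
rewrite [leLHS]Rintegral_mkcond [leRHS]Rintegral_mkcond.
have di : m.-integrable A (EFin \o (fun x => `|g x - truncate K (g x)|)).
  exact: integrable_norm (integrableB mA gA tA).
apply: le_Rintegral => //.
- by rewrite -restrict_EFin; apply/(integrable_mkcond _ mA).
- rewrite -restrict_EFin; apply/(integrable_mkcond _ mL).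
  exact: integrable_norm_sub.
- move=> x _; rewrite !patchE.
  case: (boolP (x \in [set x | K <= `|g x|])) => [_|].
    by case: (x \in A); [exact: truncate_dist_le|exact: normr_ge0].
  rewrite notin_setE/= => /negP; rewrite -ltNge => /truncate_id ->.
  by rewrite subrr normr0; case: (x \in A).
Qed.

(** Where [`|f' - f| < eps] the truncations differ by at most [eps], as
truncation is 1-Lipschitz; elsewhere they differ by at most [2 * K]. *)
Lemma truncate_integral_dist_le A K eps : measurable A ->
  measurable_fun setT f' -> measurable_fun setT f -> 0 < K -> 0 < eps ->
  `|\int[mu]_(x in A) truncate K (f' x) - \int[mu]_(x in A) truncate K (f x)| <=
  eps * fine (mu setT) + 2 * K * fine (mu [set x | eps <= `|f' x - f x|]).
Proof.
move=> mA mf' mf K0 e0.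
have ti (g : T -> R) : measurable_fun setT g ->
    mu.-integrable A (EFin \o (truncate K \o g)).
  move=> mg; apply: (@bounded_integrable _ _ _ _ _ _ K) => //.
    by apply: measurable_truncate; exact: measurable_funTS.
  by move=> x _; exact: truncate_bound.
have mL := measurable_levelT eps (measurable_funB mf' mf).
set E := [set x | _] in mL *.
rewrite -(RintegralB mA (ti _ mf') (ti _ mf)).
apply: le_trans (le_normr_Rintegral mA (integrableB mA (ti _ mf') (ti _ mf))) _.
have bi : mu.-integrable setT (EFin \o (cst (2 * K) \_ E)).
  rewrite -restrict_EFin; apply/(integrable_mkcond _ mL).
  by apply: (@bounded_integrable _ _ _ _ _ _ `|2 * K|).
have ci : mu.-integrable setT (EFin \o cst eps).
  by apply: (@bounded_integrable _ _ _ _ _ _ `|eps|).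
rewrite -(Rintegral_cst mu measurableT) -(Rintegral_cst mu mL).
rewrite [X in _ + X]Rintegral_mkcond -(RintegralD measurableT ci bi).
rewrite [leLHS]Rintegral_mkcond; apply: le_Rintegral => //.
- rewrite -restrict_EFin; apply/(integrable_mkcond _ mA).
  exact: integrable_norm (integrableB mA (ti _ mf') (ti _ mf)).
- exact: (integrableD measurableT ci bi).
- move=> x _; rewrite !patchE.
  have ? : 0 <= (if x \in E then 2 * K else 0) by case: ifP => // _; lra.
  case: (x \in A); last by apply: addr_ge0 => //; exact: ltW.
  case: (boolP (x \in E)) => [_|].
    have := truncate_bound (f' x) K0; have := truncate_bound (f x) K0.
    by rewrite /= !ler_norml => /andP[? ?] /andP[? ?]; lra.
  rewrite notin_setE/= => /negP; rewrite -ltNge => /ltW h.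
  by rewrite addr0; exact: le_trans (truncate_lip _ _ _) h.
Qed.

(** The four summands come from truncating [f'], replacing [mu'] by [mu],
replacing the truncation of [f'] by that of [f], and undoing the truncation
of [f]. *)
Lemma integral_dist_le A K eps delta : measurable A ->
  mu'.-integrable setT (EFin \o f') -> mu.-integrable setT (EFin \o f) ->
  0 < K -> 0 < eps -> (dist mu' mu <= delta%:E)%E ->
  `|\int[mu']_(x in A) f' x - \int[mu]_(x in A) f x| <=
  \int[mu']_(x in [set x | K <= `|f' x|]) `|f' x| + K * delta
  + (eps * fine (mu setT) + 2 * K * fine (mu [set x | eps <= `|f' x - f x|]))
  + \int[mu]_(x in [set x | K <= `|f x|]) `|f x|.
Proof.
move=> mA f'i fi K0 e0 distd.
have mf' := integrable_measurable f'i; have mf := integrable_measurable fi.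
have := truncate_integral_le mu'T mA f'i K0.
have := truncate_integral_le muT mA fi K0.
have := truncate_integral_dist_le mA mf' mf K0 e0.
have mt : measurable_fun A (fun x => truncate K (f' x)).
  by apply: measurable_truncate; exact: measurable_funTS.
have := dist_le_bounded mA mu'T muT mt K0
  (fun x _ => truncate_bound (f' x) K0) distd.
rewrite !ler_norml => /andP[? ?] /andP[? ?] /andP[? ?] /andP[? ?].
by apply/andP; split; lra.
Qed.

End bounds.

(** * Riesz's subsequence theorem and finiteness of the limit *)

Section convergence.
Context {d : measure_display} {T : measurableType d} {R : realType}.
Implicit Types (mu : {measure set T -> \bar R}) (g : T -> R).

(** Diagonal choice of indices, each large enough for its own property. *)
Lemma fast_subsequence (P : nat -> nat -> Prop) :
  (forall k, \forall n \near \oo, P k n) ->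
  exists2 k_ : nat -> nat, {homo k_ : i j / (i < j)%N} & forall k, P k (k_ k).
Proof.
move=> nP.
have /choice[N HN] : forall k, exists N, forall n, (N <= n)%N -> P k n.
  by move=> k; have [N _ HN] := nP k; exists N => n Nn; exact: HN.
(* Summing the successors of the thresholds makes the indices strictly increase
   and keeps each index above its own threshold. *)
exists (fun k => \sum_(i < k.+1) (N i).+1)%N => [|k].
  apply: homo_ltn => [|k]; first exact: ltn_trans.
  by rewrite [ltnRHS]big_ord_recr/= addnS ltnS leq_addr.
by apply: HN; rewrite big_ord_recr/= addnS ltnW// ltnS leq_addl.
Qed.

(** Take [k_ j] such that [`|g_ (k_ j) - g| >= 2 ^- j.+1] on a set of measure at
most [2 ^- j.+1]. By Borel-Cantelli almost every point is in finitely many of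
these sets, and at such a point the subsequence converges. *)
Lemma cvg_in_measure_ae_subseq mu (g_ : nat -> T -> R) g :
  (forall n, measurable_fun setT (g_ n)) -> measurable_fun setT g ->
  cvg_in_measure mu g_ g -> has_ae_cvg_subseq mu g_ g.
Proof.
move=> mg_ mg cg.
pose F k n := [set s | ((2 ^+ k.+1)^-1 <= `|g_ n s - g s|)%R].
have half0 k : (0 < (2 ^+ k.+1)^-1 :> R)%R by rewrite invr_gt0 exprn_gt0.
have mF k n : measurable (F k n).
  by apply: measurable_levelT; exact: measurable_funB.
have [k kmono Fk] : exists2 k_ : nat -> nat, {homo k_ : i j / (i < j)%N} &
    forall k, mu (F k (k_ k)) <= ((2 ^+ k.+1)^-1)%:E.
  apply: (@fast_subsequence (fun k n => mu (F k n) <= ((2 ^+ k.+1)^-1)%:E)) => k.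
  exact: (cvge0_leP (fun n => measure_ge0 mu (F k n))).1 (cg _ (half0 k)) _ _.
exists k => //.
exists (lim_sup_set (fun j => F j (k j))); split.
- by apply: bigcapT_measurable => n; exact: bigcup_measurable.
- apply: lim_sup_set_cvg0 => //.
  apply: (@le_lt_trans _ _ 1%:E); last by rewrite ltry.
  apply: le_trans (epsilon_trick0 xpredT (@ler01 R)).
  apply: lee_nneseries => // n _.
  by rewrite div1r natrX; exact: Fk.
- move=> s /= ncvg; apply: contrapT => nlim; apply: ncvg.
  move: nlim => /existsNP[n /not_implyP[_ nF]].
  apply/cvgrPdist_lt => e e0.
  have small : \forall j \near \oo, ((2 ^+ j.+1)^-1 < e)%R.
    have half1 : (`|2^-1 : R| < 1)%R.
      by rewrite ger0_norm ?invr_ge0// invf_lt1// ltr1n.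
    have /cvgrPdist_lt/(_ e e0) := cvg_geometric (2^-1)%R half1.
    by apply: filterS => j; rewrite sub0r normrN /= -exprS exprVn ger0_norm.
  near=> j.
  rewrite distrC; apply: (@lt_trans _ _ (2 ^+ j.+1)^-1%R); last by near: j.
  rewrite ltNge; apply/negP => Fj; apply: nF; exists j => //=.
  by near: j; exact: nbhs_infty_ge.
Unshelve. all: by end_near. Qed.

Lemma dist_ge0 (mu' mu : {measure set T -> \bar R}) : 0 <= dist mu' mu.
Proof.
apply: ereal_sup_ubound; exists (cst 0%R).
  by split=> // x /=; rewrite lerN10 ler01.
by rewrite /= !integral0 subee// abse0.
Qed.

(** The test function 1 compares the total masses: if that of [mu] were infinite,
every [dist (mu_ n) mu] would be infinite. *)
Lemma cvg_tv_finite (mu_ : nat -> {finite_measure set T -> \bar R}) mu :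
  cvg_tv mu_ mu -> mu setT < +oo.
Proof.
move=> /(cvge0_leP (fun n => dist_ge0 (mu_ n) mu)) /(_ _ (@ltr01 R)) [N _ HN].
rewrite ltey; apply/eqP => muT.
have := HN N (leqnn N); apply/negP; rewrite -ltNge.
apply: (@lt_le_trans _ _ +oo); first by rewrite ltry.
apply: ereal_sup_ubound; exists (cst 1%R).
  by split=> // x /=; rewrite lexx andbT (le_trans _ ler01)// lerN10.
rewrite /= !integral_cst// !mul1e muT.
set x := (X in X - _); have : x \is a fin_num by exact: fin_num_measure.
by move=> /fineK <-.
Qed.

(** * The two directions of the equivalence *)

Section equivalence.
Variables (mu_ : nat -> {finite_measure set T -> \bar R})
  (mu : {measure set T -> \bar R}).
Variables (nu_ : nat -> {charge set T -> \bar R}) (nu : {charge set T -> \bar R}).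
Variables (g_ : nat -> T -> R) (g : T -> R).
Hypotheses (RN_g : is_RN nu mu g) (RN_g_ : forall n, is_RN (nu_ n) (mu_ n) (g_ n)).
Hypothesis mu_cvg : cvg_tv mu_ mu.

Let muT : mu setT < +oo. Proof. exact: cvg_tv_finite mu_cvg. Qed.
Let mu_T n : mu_ n setT < +oo.
Proof. by rewrite -ge0_fin_numE// fin_num_measure. Qed.
Let gi : mu.-integrable setT (EFin \o g). Proof. by case: RN_g. Qed.
Let g_i n : (mu_ n).-integrable setT (EFin \o g_ n).
Proof. by case: (RN_g_ n). Qed.
Let mg : measurable_fun setT g. Proof. exact: integrable_measurable gi. Qed.
Let mg_ n : measurable_fun setT (g_ n).
Proof. exact: integrable_measurable (g_i n). Qed.

Let level n K := [set s | (K <= `|g_ n s|)%R].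

Let mlevel n K : measurable (level n K).
Proof. exact: measurable_levelT. Qed.

Let near_dist (delta : R) : (0 < delta)%R ->
  \forall n \near \oo, dist (mu_ n) mu <= delta%:E.
Proof. exact: (cvge0_leP (fun n => dist_ge0 (mu_ n) mu)).1 mu_cvg delta. Qed.

Let charge_dist n A : measurable A ->
  `|nu_ n A - nu A| =
  (`|\int[mu_ n]_(x in A) g_ n x - \int[mu]_(x in A) g x|)%R%:E.
Proof.
move=> mA; have [_ ->//] := RN_g; have [_ ->//] := RN_g_ n.
rewrite -(EFin_Rintegral mA (integrable_sub mA (g_i n))).
by rewrite -(EFin_Rintegral mA (integrable_sub mA gi)).
Qed.

Let sup_charge_dist_ge0 n :
  0 <= ereal_sup [set `|nu_ n A - nu A| | A in measurable].
Proof.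
apply: (@le_trans _ _ `|nu_ n set0 - nu set0|) => //.
by apply: ereal_sup_ubound; exists set0.
Qed.

Let near_charge_dist (eta : R) : charge_cvg_tv nu_ nu -> (0 < eta)%R ->
  \forall n \near \oo, forall A, measurable A ->
  (`|\int[mu_ n]_(x in A) g_ n x - \int[mu]_(x in A) g x| <= eta)%R.
Proof.
move=> /(cvge0_leP sup_charge_dist_ge0) H eta0; have := H _ eta0.
apply: filterS => n Hn A mA; rewrite -lee_fin -charge_dist//.
by apply: le_trans Hn; apply: ereal_sup_ubound; exists A.
Qed.

(** The set where [`|g_ n - g| >= e] is covered by the set where [`|g| >= K] and
by the two sets where [`|g| <= K] and [g_ n] exceeds [g], or [g] exceeds [g_ n],
by [e]. The first is small for a fixed large [K]; the other two are then small
for large [n] by [excess_measure_le]. *)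
Lemma charge_cvg_tv_in_measure :
  charge_cvg_tv nu_ nu -> cvg_in_measure mu g_ g.
Proof.
move=> nu_cvg e e0; apply/cvge0_leP => // tau tau0.
have tau3 : (0 < tau / 3)%R by rewrite divr_gt0.
have [K K0 muK] : exists2 K : R, (0 < K)%R &
    mu [set s | (K <= `|g s|)%R] <= (tau / 3)%:E.
  apply: pinfty_ex_gt0.
  exact: (cvge0_leP (fun K => measure_ge0 mu _)).1 (cvg_measure_level gi) _ tau3.
(* The value that makes the bound of [excess_measure_le] equal to [e * (tau / 3)]. *)
pose eta := (tau / 3 * e / (1 + K + e))%R.
have Ke0 : (0 < 1 + K + e)%R by lra.
have eta0 : (0 < eta)%R by rewrite divr_gt0// mulr_gt0.
have etaE : (eta + (K + e) * eta = e * (tau / 3))%R.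
  by rewrite /eta; field; rewrite gt_eqF.
near=> n.
have dn : dist (mu_ n) mu <= eta%:E by near: n; exact: near_dist.
have cn A : measurable A ->
    (`|\int[mu_ n]_(x in A) g_ n x - \int[mu]_(x in A) g x| <= eta)%R.
  by move: A; near: n; exact: near_charge_dist.
have mle (f1 f2 : T -> R) : measurable_fun setT f1 -> measurable_fun setT f2 ->
    measurable [set s | (f1 s <= f2 s)%R].
  by move=> m1 m2; rewrite -[X in measurable X]setTI; exact: measurable_fun_le.
have mB : measurable [set s | (`|g s| <= K)%R].
  by apply: mle => //; exact: measurableT_comp.
pose U := [set s | (`|g s| <= K)%R] `&` [set s | (g s + e <= g_ n s)%R].
pose L := [set s | (`|g s| <= K)%R] `&` [set s | (g_ n s + e <= g s)%R].
have mU : measurable U.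
  by apply: measurableI => //; apply: mle => //; exact: measurable_funD.
have mL : measurable L.
  by apply: measurableI => //; apply: mle => //; exact: measurable_funD.
have fm A : measurable A -> mu A = (fine (mu A))%:E.
  by move=> mA; rewrite fineK// ge0_fin_numE//; exact: fin_measure.
have muU : mu U <= (tau / 3)%:E.
  rewrite fm// lee_fin -(ler_pM2l e0) -etaE.
  by apply: (excess_measure_le (mu_T n) muT mU (g_i n) gi K0 e0 dn (cn _ mU)).
have muL : mu L <= (tau / 3)%:E.
  rewrite fm// lee_fin -(ler_pM2l e0) -etaE.
  (* The lower deviation of [g_ n] is the excess of [- g_ n] over [- g]. *)
  have RN (m : {measure set T -> \bar R}) f : m.-integrable setT (EFin \o f) ->
      (\int[m]_(x in L) - f x = - \int[m]_(x in L) f x)%R.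
    move=> fi; rewrite -mulN1r -RintegralZl//; last exact: integrable_sub.
    by apply: eq_Rintegral => x _; rewrite mulN1r.
  apply: (@excess_measure_le _ _ _ (mu_ n) mu (fun x => - g_ n x)%R
    (fun x => - g x)%R (mu_T n) muT L) => //.
  - exact: integrableN (g_i n).
  - exact: integrableN gi.
  - by rewrite !RN ?normrN -?opprD ?normrN; [exact: cn|exact: gi|exact: g_i].
  - by move=> x [/= ? ?]; rewrite normrN; split => //; lra.
have mE : measurable [set s | (e <= `|g_ n s - g s|)%R].
  by apply: measurable_levelT; exact: measurable_funB.
have mg_K := measurable_levelT K mg.
apply: (@le_trans _ _ (mu ([set s | (K <= `|g s|)%R] `|` (U `|` L)))).
  apply: le_measure; rewrite ?inE//; first by do 2 apply: measurableU => //.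
  move=> s /= es; have [?|/ltW gK] := leP K `|g s|%R; first by left.
  right; move: es; rewrite ler_normr => /orP[?|?]; [left|right]; split => //=; lra.
rewrite (_ : tau = tau / 3 + (tau / 3 + tau / 3))%R; last by field.
rewrite 2!EFinD; apply: le_trans (measureU2 _ _ _) _ => //.
  exact: measurableU.
apply: leeD => //; apply: le_trans (measureU2 _ _ _) _ => //.
exact: leeD.
Unshelve. all: by end_near. Qed.

Let sup_variation_ge0 K :
  0 <= ereal_sup [set density_variation (mu_ n) (g_ n) (level n K)
                 | n in [set: nat]].
Proof.
apply: le_trans (density_variation_ge0 (mu_ 0%N) (g_ 0%N) (level 0%N K)) _.
by apply: ereal_sup_ubound; exists 0%N.
Qed.

(** For all but finitely many [n], [integral_norm_le] moves the tail of [g_ n] to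
the integral of [`|g|] over the set where [`|g_ n| >= K]. That set lies in the
union of those where [`|g| >= K - 1] and [`|g_ n - g| >= 1], so it has small
measure uniformly in [n]. The finitely many other [n] are handled one by
one. *)
Lemma charge_cvg_tv_uniform_integrability : charge_cvg_tv nu_ nu ->
  ereal_sup [set density_variation (mu_ n) (g_ n) (level n K)
            | n in [set: nat]] @[K --> +oo%R] --> 0.
Proof.
move=> nu_cvg; apply/cvge0_leP => // e e0.
have e2 : (0 < e / 2)%R by rewrite divr_gt0.
have e4 : (0 < e / 4)%R by rewrite divr_gt0.
have [d0 [d00 small]] := integral_normr_continuous gi e2.
have d3 : (0 < d0 / 3)%R by rewrite divr_gt0.
have [N _ HN] : \forall n \near \oo,
    mu [set s | (1 <= `|g_ n s - g s|)%R] <= (d0 / 3)%:E /\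
    forall A, measurable A ->
      (`|\int[mu_ n]_(x in A) g_ n x - \int[mu]_(x in A) g x| <= e / 4)%R.
  apply: filterI; last exact: near_charge_dist.
  have := charge_cvg_tv_in_measure nu_cvg (@ltr01 R).
  by move=> /(cvge0_leP (fun n => measure_ge0 mu _)); exact.
have muK : \forall K \near +oo%R, mu [set s | (K <= `|g s|)%R] <= (d0 / 3)%:E.
  exact: (cvge0_leP (fun K => measure_ge0 mu _)).1 (cvg_measure_level gi) _ d3.
have [M [_ HM]] := muK.
near=> K.
apply: ge_ereal_sup => _ [n _ <-].
have [nN|Nn] := ltnP n N.
  move: n nN; near: K.
  apply: near_forall_ltn => n.
  exact: (cvge0_leP (fun K => density_variation_ge0 _ _ _)).1
    (cvg_density_variation_level (g_i n)) _ e0.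
have [mun1 cn] := HN _ Nn.
rewrite density_variationE//; last exact: g_i.
rewrite lee_fin.
apply: le_trans (integral_norm_le (mlevel n K) (g_i n) gi cn) _.
have : (\int[mu]_(x in level n K) `|g x| < e / 2)%R; last by lra.
apply: small => //.
have muK1 : mu [set s | (K - 1 <= `|g s|)%R] <= (d0 / 3)%:E.
  apply: HM; rewrite ltrBrDr; near: K; apply: nbhs_pinfty_gt; exact: num_real.
have mK1 := measurable_levelT (K - 1) mg.
have mD := measurable_levelT 1 (measurable_funB (mg_ n) mg).
apply: (@le_lt_trans _ _ (mu ([set s | (K - 1 <= `|g s|)%R] `|`
    [set s | (1 <= `|g_ n s - g s|)%R]))).
  apply: le_measure; rewrite ?inE//; first exact: measurableU.
  move=> s Ks; have {}Ks : (K <= `|g_ n s|)%R := Ks; rewrite /=.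
  have [?|gK] := leP (K - 1)%R `|g s|%R; [by left|right].
  rewrite /=; have := lerB_dist (g_ n s) (g s); lra.
apply: (@le_lt_trans _ _ ((d0 / 3)%:E + (d0 / 3)%:E)).
  by apply: le_trans (measureU2 _ _ _) _ => //; exact: leeD.
by rewrite -EFinD lte_fin; lra.
Unshelve. all: by end_near. Qed.

(** In [integral_dist_le] the order of choices matters: [K] makes both tails
small, uniformly in [n], then [eps] is chosen, and only then is [n] taken large
in terms of [K] and [eps]. Each of the five error terms is at most [e / 5]. *)
Lemma in_measure_charge_cvg_tv : cvg_in_measure mu g_ g ->
  ereal_sup [set density_variation (mu_ n) (g_ n) (level n K)
            | n in [set: nat]] @[K --> +oo%R] --> 0 ->
  charge_cvg_tv nu_ nu.
Proof.
move=> g_cvg /(cvge0_leP sup_variation_ge0) ui.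
apply/cvge0_leP => // e e0.
have e5 : (0 < e / 5)%R by rewrite divr_gt0.
have [K K0 [uiK tailK]] : exists2 K : R, (0 < K)%R &
    ereal_sup [set density_variation (mu_ n) (g_ n) (level n K)
              | n in [set: nat]] <= (e / 5)%:E /\
    density_variation mu g [set s | (K <= `|g s|)%R] <= (e / 5)%:E.
  apply: pinfty_ex_gt0; apply: filterI; first exact: ui.
  exact: (cvge0_leP (fun K => density_variation_ge0 _ _ _)).1
    (cvg_density_variation_level gi) _ e5.
set m := fine (mu setT).
have m0 : (0 <= m)%R by exact: fine_ge0.
(* Adding 1 covers the case where [mu] is the zero measure. *)
pose eps := (e / 5 / (m + 1))%R.
have eps0 : (0 < eps)%R by rewrite divr_gt0// ltr_wpDl.
have epsm : (eps * m <= e / 5)%R.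
  rewrite /eps mulrAC ler_pdivrMr ?ltr_wpDl// ler_wpM2l ?lerDl//.
  exact: ltW.
near=> n.
have dn : dist (mu_ n) mu <= (e / 5 / K)%:E.
  by near: n; apply: near_dist; rewrite divr_gt0.
have mun : mu [set s | (eps <= `|g_ n s - g s|)%R] <= (e / 5 / (2 * K))%:E.
  near: n; apply: (cvge0_leP (fun n => measure_ge0 mu _)).1 (g_cvg _ eps0) _ _.
  by rewrite divr_gt0// mulr_gt0.
have mE := measurable_levelT eps (measurable_funB (mg_ n) mg).
have {}mun : (2 * K * fine (mu [set s | eps <= `|g_ n s - g s|]) <= e / 5)%R.
  rewrite -ler_pdivlMl ?mulr_gt0// mulrC -lee_fin fineK//.
  by rewrite ge0_fin_numE//; exact: fin_measure.
have tailn : (\int[mu_ n]_(x in level n K) `|g_ n x| <= e / 5)%R.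
  rewrite -lee_fin -density_variationE//; last exact: g_i.
  apply: le_trans uiK.
  by apply: ereal_sup_ubound; exists n.
have {}tailK : (\int[mu]_(x in [set s | K <= `|g s|]) `|g x| <= e / 5)%R.
  by rewrite -lee_fin -density_variationE//; exact: measurable_levelT.
apply: ge_ereal_sup => _ [A mA <-].
rewrite charge_dist// lee_fin.
apply: le_trans (integral_dist_le (mu_T n) muT mA (g_i n) gi K0 eps0 dn) _.
have -> : (K * (e / 5 / K) = e / 5)%R by field; rewrite gt_eqF.
rewrite -/m; move: tailn; rewrite /level; lra.
Unshelve. all: by end_near. Qed.

End equivalence.

End convergence.

Unset Implicit Arguments.

Theorem corollary1p12 (d : measure_display) (T : measurableType d)
    (R : realType)
    (mu_ : nat -> {finite_measure set T -> \bar R})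
    (mu : {measure set T -> \bar R})
    (nu_ : nat -> {charge set T -> \bar R}) (nu : {charge set T -> \bar R})
    (nu_mu : nu `<< mu) (nu_mu_ : forall n, nu_ n `<< mu_ n)
    (g_ : nat -> T -> R) (g : T -> R)
    (RN_g : is_RN nu mu g) (RN_g_ : forall n, is_RN (nu_ n) (mu_ n) (g_ n))
    (mu_cvg : cvg_tv mu_ mu) :
  (cvg_in_measure mu g_ g -> has_ae_cvg_subseq mu g_ g) /\
  (charge_cvg_tv nu_ nu <->
    (cvg_in_measure mu g_ g /\ has_ae_cvg_subseq mu g_ g) /\
    ereal_sup [set density_variation (mu_ n) (g_ n)
                     [set s | (K <= `|g_ n s|)%R] | n in [set: nat]]
      @[K --> +oo%R] --> 0).
Proof.
have subseq : cvg_in_measure mu g_ g -> has_ae_cvg_subseq mu g_ g.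
  apply: cvg_in_measure_ae_subseq => [n|].
    by apply: integrable_measurable; case: (RN_g_ n) => + _; exact.
  by apply: integrable_measurable; case: RN_g => + _; exact.
split=> //; split=> [nu_cvg|[[g_cvg _] ui]].
  have g_cvg := charge_cvg_tv_in_measure RN_g RN_g_ mu_cvg nu_cvg.
  split; first by split=> //; exact: subseq.
  exact: charge_cvg_tv_uniform_integrability RN_g RN_g_ mu_cvg nu_cvg.
exact: in_measure_charge_cvg_tv RN_g RN_g_ mu_cvg g_cvg ui.
Qed.
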